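(* Let $K,N,M\in\mathbb N$, let $(\mu^{(k)},\nu^{(k)})\in\Delta_N\times\Delta_M$, $k\in\{1,\dots,K\}$, be $K$ distinct pairs of marginals, and let $\alpha^{(k)}\in\mathbb R$ (total costs) and $\pi^{(k)}\in\Pi(\mu^{(k)},\nu^{(k)})$ (optimal transport plans), $k\in\{1,\dots,K\}$, be observed. For each $k$ let $\{u^{(\ell,k)}:\ell\in\{1,\dots,L_k\}\}\subseteq\operatorname{EP}(\mu^{(k)},\nu^{(k)})$ be a family of extreme points as described in the context. Consider the following system in the unknown $c\in\mathbb R^{N\times M}$: $$\langle c,v^{(k)}\rangle\ge\alpha^{(k)}\ \text{ for all } v^{(k)}\in\operatorname{EP}(\mu^{(k)},\nu^{(k)})\setminus\{u^{(\ell,k)}:\ell\in\{1,\dots,L_k\}\},\ k\in\{1,\dots,K\},$$ $$\langle c,u^{(\ell,k)}\rangle=\alpha^{(k)}\ \text{ for all }\ell\in\{1,\dots,L_k\},\ k\in\{1,\dots,K\}.\tag{$*$}$$ (a) Suppose that at least one consistent cost matrix exists. Then the cost matrix is identifiable in $\mathbb R^{N\times M}$ from the marginals, total costs and optimal transport plans if and only if the system $( * )$ has a unique solution. (b) (Without assuming in advance that a consistent cost matrix exists.) If $( * )$ has a solution, then a consistent cost matrix exists.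
   Context: $\Delta_N=\{x\in\mathbb R^N: x_i\ge 0,\ \sum_i x_i=1\}$. For $\mu\in\Delta_N$, $\nu\in\Delta_M$, $\Pi(\mu,\nu)$ is the set of $N\times M$ matrices with nonnegative entries, row sums $\mu$ and column sums $\nu$; $\operatorname{EP}(\mu,\nu)$ is the finite set of its extreme points. For $c\in\mathbb R^{N\times M}$, $\mathcal T_c(\mu,\nu)=\min_{\pi\in\Pi(\mu,\nu)}\langle c,\pi\rangle$, with $\langle\cdot,\cdot\rangle$ the Frobenius inner product, and minimizers are called optimal transport plans. Families $u^{(\ell,k)}$: for each $k$, $L_k\in\mathbb N$ and $u^{(1,k)},\dots,u^{(L_k,k)}\in\operatorname{EP}(\mu^{(k)},\nu^{(k)})$ are such that $\pi^{(k)}=\sum_{\ell=1}^{L_k}\lambda_\ell u^{(\ell,k)}$ for some $\lambda\in\Delta_{L_k}$ with all $\lambda_\ell>0$. Such families always exist (e.g. all vertices of the smallest face of $\Pi(\mu^{(k)},\nu^{(k)})$ containing $\pi^{(k)}$), and whenever $\pi^{(k)}$ is optimal for a cost matrix, so is every element of $\operatorname{conv}\{u^{(\ell,k)}:\ell\in\{1,\dots,L_k\}\}$. Here the observed information consists of the marginals, total costs and optimal transport plans. A cost matrix $c$ is consistent if $\mathcal T_c(\mu^{(k)},\nu^{(k)})=\alpha^{(k)}=\langle c,\pi^{(k)}\rangle$ for all $k$. When discussing identifiability it is always assumed that at least one consistent cost matrix exists (the underlying cost matrix); the cost matrix is identifiable in $\mathbb R^{N\times M}$ if there is exactly one consistent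 cost matrix. *)

(* Defs.v *)
From mathcomp Require Import all_boot all_order all_algebra.
From mathcomp Require Import all_classical all_reals all_analysis.

Set Implicit Arguments.
Unset Strict Implicit.
Unset Printing Implicit Defensive.

Import Order.TTheory GRing.Theory Num.Theory.
Import numFieldNormedType.Exports.

Local Open Scope classical_set_scope.
Local Open Scope ring_scope.

Definition simplex (R : realType) (n : nat) : set 'rV[R]_n :=
  [set x | (forall i, 0 <= x 0 i) /\ \sum_i x 0 i = 1].

Definition frobenius (R : realType) (N M : nat) (c p : 'M[R]_(N, M)) : R :=
  \sum_i \sum_j c i j * p i j.

Definition couplings (R : realType) (N M : nat)
    (mu : 'rV[R]_N) (nu : 'rV[R]_M) : set 'M[R]_(N, M) :=
  [set p | [/\ forall i j, 0 <= p i j,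
               forall i, \sum_j p i j = mu 0 i
             & forall j, \sum_i p i j = nu 0 j]].

Definition extreme_points (R : realType) (V : lmodType R) (A : set V) : set V :=
  [set x | A x /\ forall y z (t : R), A y -> A z -> 0 < t < 1 ->
                    x = t *: y + (1 - t) *: z -> y = x /\ z = x].

(* The infimum is a minimum whenever mu and nu are probability vectors: see
   [ot_cost_min] below. *)
Definition ot_cost (R : realType) (N M : nat) (c : 'M[R]_(N, M))
    (mu : 'rV[R]_N) (nu : 'rV[R]_M) : R :=
  inf [set frobenius c p | p in couplings mu nu].

Definition generating_family (R : realType) (N M L : nat)
    (mu : 'rV[R]_N) (nu : 'rV[R]_M) (p : 'M[R]_(N, M))
    (u : 'I_L -> 'M[R]_(N, M)) : Prop :=
  (forall l, extreme_points (couplings mu nu) (u l)) /\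
  exists lam : 'rV[R]_L,
    [/\ simplex lam, forall l, 0 < lam 0 l & p = \sum_l lam 0 l *: u l].

Definition consistent (R : realType) (K N M : nat)
    (mu : 'I_K -> 'rV[R]_N) (nu : 'I_K -> 'rV[R]_M)
    (alpha : 'I_K -> R) (p : 'I_K -> 'M[R]_(N, M)) (c : 'M[R]_(N, M)) : Prop :=
  forall k, ot_cost c (mu k) (nu k) = alpha k /\ alpha k = frobenius c (p k).

Definition identifiable (R : realType) (K N M : nat)
    (mu : 'I_K -> 'rV[R]_N) (nu : 'I_K -> 'rV[R]_M)
    (alpha : 'I_K -> R) (p : 'I_K -> 'M[R]_(N, M)) : Prop :=
  exists! c : 'M[R]_(N, M), consistent mu nu alpha p c.

Definition solves_system (R : realType) (K N M : nat)
    (mu : 'I_K -> 'rV[R]_N) (nu : 'I_K -> 'rV[R]_M) (alpha : 'I_K -> R)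
    (L : 'I_K -> nat) (u : forall k, 'I_(L k) -> 'M[R]_(N, M))
    (c : 'M[R]_(N, M)) : Prop :=
  (forall k v,
     (extreme_points (couplings (mu k) (nu k)) `\` range (u k)) v ->
     alpha k <= frobenius c v) /\
  (forall k l, frobenius c (u k l) = alpha k).

Lemma sum_continuous (R : realType) (T : topologicalType) (I : Type)
    (r : seq I) (f : I -> T -> R) :
  (forall i, continuous (f i)) -> continuous (fun x => \sum_(i <- r) f i x).
Proof.
move=> fc; elim: r => [|i r IH].
  rewrite (_ : (fun _ => _) = fun=> 0); first by move=> x; exact: cvg_cst.
  by apply/funext => y; rewrite big_nil.
rewrite (_ : (fun _ => _) = fun y => f i y + \sum_(j <- r) f j y).
  by move=> x; apply: cvgD; [exact: fc|exact: IH].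
by apply/funext => y; rewrite big_cons.
Qed.

Lemma ot_cost_min (R : realType) (N M : nat) (c : 'M[R]_(N, M))
    (mu : 'rV[R]_N) (nu : 'rV[R]_M) : simplex mu -> simplex nu ->
  exists2 p, couplings mu nu p &
    ot_cost c mu nu = frobenius c p /\
    forall q, couplings mu nu q -> frobenius c p <= frobenius c q.
Proof.
move=> [mu0 mu1] [nu0 nu1].
pose S := [set v : 'rV[R]_(N * M) | couplings mu nu (vec_mx v)].
have vE i j : continuous (fun v : 'rV[R]_(N * M) => vec_mx v i j).
  rewrite (_ : (fun _ => _) = fun v : 'rV_(N * M) => v 0 (mxvec_index i j)).
    exact: coord_continuous.
  by apply/funext => v; rewrite mxE.
have S0 : S !=set0.
  exists (mxvec (\matrix_(i, j) (mu 0 i * nu 0 j))); rewrite /S /= mxvecK.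
  split=> [i j|i|j].
  - by rewrite mxE mulr_ge0.
  - by under eq_bigr do rewrite mxE; rewrite -mulr_sumr nu1 mulr1.
  - by under eq_bigr do rewrite mxE; rewrite -mulr_suml mu1 mul1r.
have Scl : closed S.
  rewrite (_ : S = (\bigcap_i \bigcap_j [set v | 0 <= vec_mx v i j]) `&`
    (\bigcap_i [set v | \sum_j vec_mx v i j = mu 0 i]) `&`
    (\bigcap_j [set v | \sum_i vec_mx v i j = nu 0 j])).
    apply: closedI; [apply: closedI|].
    - apply: closed_bigI => i _; apply: closed_bigI => j _.
      by apply: (@preimage_closed _ _ (fun v : 'rV[R]_(N * M) => vec_mx v i j)
        [set x : R | 0 <= x]) => [v _|];
        [exact: vE|exact: closed_ge].
    - apply: closed_bigI => i _.
      apply: (@preimage_closed _ _ (fun v : 'rV[R]_(N * M) => \sum_j vec_mx v i j)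
        [set x : R | x = mu 0 i]) => [v _|]; last exact: closed_eq.
      exact: (sum_continuous (fun j => vE i j)).
    - apply: closed_bigI => j _.
      apply: (@preimage_closed _ _ (fun v : 'rV[R]_(N * M) => \sum_i vec_mx v i j)
        [set x : R | x = nu 0 j]) => [v _|]; last exact: closed_eq.
      exact: (sum_continuous (fun i => vE i j)).
  apply/seteqP; split=> v /=.
    move=> [h1 h2 h3]; split; [split|] => [i _ j _|i _|j _] /=.
    + exact: h1.
    + exact: h2.
    + exact: h3.
  by move=> [[h1 h2] h3]; split=> [i j|i|j];
    [exact: (h1 i I j I)|exact: (h2 i I)|exact: (h3 j I)].
have Sc : compact S.
  apply: (@subclosed_compact _ S
    [set v : 'rV[R]_(N * M) | forall k, `[0, 1]%classic (v ord0 k)]) => //.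
    by apply: (@rV_compact R _ (fun=> `[0, 1]%classic)) => _;
      exact: segment_compact.
  move=> v [h1 h2 h3] k; case/mxvec_indexP: k => i j.
  have -> : v 0 (mxvec_index i j) = vec_mx v i j by rewrite mxE.
  rewrite /= in_itv /= h1 /=.
  apply: (@le_trans _ _ (mu 0 i)).
    by rewrite -h2 (bigD1 j) //= lerDl sumr_ge0.
  by rewrite -mu1 (bigD1 i) //= lerDl sumr_ge0.
have fc : continuous (fun v : 'rV[R]_(N * M) => frobenius c (vec_mx v)).
  apply: sum_continuous => i; apply: sum_continuous => j v.
  by apply: (@continuousM _ _ (fun=> c i j) (fun v => vec_mx v i j) v);
    [exact: cst_continuous|exact: vE].
have [v vS vmin] := compact_EVT_min S0 Sc (continuous_subspaceT fc).
rewrite inE in vS; exists (vec_mx v) => //.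
have pmin q : couplings mu nu q -> frobenius c (vec_mx v) <= frobenius c q.
  by move=> hq; rewrite -(mxvecK q); apply: vmin; rewrite inE /S /= mxvecK.
split=> //; apply/eqP; rewrite eq_le; apply/andP; split.
  apply: ge_inf; last by exists (vec_mx v).
  by exists (frobenius c (vec_mx v)) => _ [q hq <-]; exact: pmin.
apply: lb_le_inf; first by exists (frobenius c (vec_mx v)), (vec_mx v).
by move=> _ [q hq <-]; exact: pmin.
Qed.

(* Main.v *)
Require Import Defs.
From mathcomp Require Import all_boot all_order all_algebra.
From mathcomp Require Import all_classical all_reals all_analysis.
From mathcomp Require Import lra.

(** A cost matrix is consistent if and only if it solves the system, so both
    claims follow at once: the two solution sets coincide, and uniqueness and
    existence are transferred from one to the other
    ([consistent_solves_system]).  The equivalence is proved one pair of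
    marginals at a time.

    If [c] is consistent, no coupling costs less than [alpha], and the average
    of the costs of the [u l], with positive weights, is the cost [alpha] of
    the observed plan; an average of numbers at least [alpha] can only equal
    [alpha] when all of them do ([weighted_mean_eq_lb]).

    If [c] solves the system, every extreme point of the transport polytope
    costs at least [alpha], and the plan costs [alpha] by linearity.  What
    remains is that a linear cost bounded below on the extreme points is
    bounded below on the whole polytope ([extreme_point_below]).  Starting at
    a coupling that is not extreme, there is a line through it inside the
    affine hull of its face ([nonextreme_direction]).  Moving along this line
    in the direction in which the cost does not increase, one must leave the
    nonnegative orthant, because a nonzero matrix with zero row sums has a
    negative entry; at the exit point an entry of the coupling has vanished
    and the others that were zero still are ([push_to_boundary]).  The support
    thus shrinks strictly, and the process ends at an extreme point. *)

Set Implicit Arguments.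
Unset Strict Implicit.
Unset Printing Implicit Defensive.

Import Order.TTheory GRing.Theory Num.Theory.

Local Open Scope classical_set_scope.
Local Open Scope ring_scope.

(** * Linearity of the cost and weighted means *)

Lemma frobeniusDr (R : realType) (N M : nat) (c p q : 'M[R]_(N, M)) :
  frobenius c (p + q) = frobenius c p + frobenius c q.
Proof.
rewrite /frobenius -big_split /=; apply: eq_bigr => i _.
by rewrite -big_split /=; apply: eq_bigr => j _; rewrite mxE mulrDr.
Qed.

Lemma frobeniusZr (R : realType) (N M : nat) (c p : 'M[R]_(N, M)) (a : R) :
  frobenius c (a *: p) = a * frobenius c p.
Proof.
rewrite /frobenius mulr_sumr; apply: eq_bigr => i _.
by rewrite mulr_sumr; apply: eq_bigr => j _; rewrite mxE mulrCA.
Qed.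

Lemma frobenius_sumr (R : realType) (N M L : nat) (c : 'M[R]_(N, M))
    (lam : 'I_L -> R) (u : 'I_L -> 'M[R]_(N, M)) :
  frobenius c (\sum_l lam l *: u l) = \sum_l lam l * frobenius c (u l).
Proof.
rewrite (big_morph (frobenius c) (@frobeniusDr R N M c) (_ : _ 0 = 0)).
  by apply: eq_bigr => l _; rewrite frobeniusZr.
by rewrite -[X in frobenius c X](scale0r 0) frobeniusZr mul0r.
Qed.

(** The deviations [x l - a] are nonnegative and their positively weighted sum
    is zero. *)
Lemma weighted_mean_eq_lb (R : realType) (L : nat) (lam : 'rV[R]_L)
    (x : 'I_L -> R) (a : R) :
  simplex lam -> (forall l, 0 < lam 0 l) -> (forall l, a <= x l) ->
  \sum_l lam 0 l * x l = a -> forall l, x l = a.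
Proof.
move=> [_ lam1] lam_gt0 ax mean l.
have dev : \sum_i lam 0 i * (x i - a) = 0.
  under eq_bigr do rewrite mulrBr.
  by rewrite sumrB mean -mulr_suml lam1 mul1r subrr.
have dev_ge0 i : true -> 0 <= lam 0 i * (x i - a).
  by move=> _; rewrite mulr_ge0 ?subr_ge0 // ltW.
have /eqP := psumr_eq0P dev_ge0 dev (i := l) isT.
by rewrite mulf_eq0 gt_eqF //= subr_eq0 => /eqP.
Qed.

(** * Descending to an extreme point of the transport polytope *)

(** The direction is the difference of the endpoints of a segment in the
    polytope with [q] in its interior: both endpoints vanish wherever [q]
    does, by nonnegativity, and they have the same marginals. *)
Lemma nonextreme_direction (R : realType) (N M : nat) (mu : 'rV[R]_N)
    (nu : 'rV[R]_M) (q : 'M[R]_(N, M)) :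
  couplings mu nu q -> ~ extreme_points (couplings mu nu) q ->
  exists d : 'M[R]_(N, M),
    [/\ d != 0, forall i, \sum_j d i j = 0, forall j, \sum_i d i j = 0
      & forall i j, q i j = 0 -> d i j = 0].
Proof.
move=> qC qNext; apply: contra_notP qNext => noDir; split=> // y z t yC zC.
move=> /andP[t0 t1] qE.
suff yz : y = z.
  have qy : q = y by rewrite qE -yz -scalerDl addrC subrK scale1r.
  by rewrite -yz qy.
apply/eqP; rewrite -subr_eq0; apply/negPn/negP => yz; apply: noDir.
case: yC zC => y0 yr yc [z0 zr zc].
exists (y - z); split=> // [i|j|i j q0].
- by under eq_bigr do rewrite !mxE; rewrite sumrB yr zr subrr.
- by under eq_bigr do rewrite !mxE; rewrite sumrB yc zc subrr.
have := y0 i j; have := z0 i j; move: q0; rewrite qE !mxE => q0 zij yij.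
have ty : 0 <= t * y i j by rewrite mulr_ge0 // ltW.
have tz : 0 <= (1 - t) * z i j by rewrite mulr_ge0 // subr_ge0 ltW.
have /eqP : t * y i j = 0 by lra.
have /eqP : (1 - t) * z i j = 0 by lra.
rewrite !mulf_eq0 (gt_eqF t0) subr_eq0 (gt_eqF t1) /=.
by move=> /eqP -> /eqP ->; rewrite subrr.
Qed.

Lemma exists_negative_entry (R : realType) (N M : nat) (d : 'M[R]_(N, M)) :
  d != 0 -> (forall i, \sum_j d i j = 0) ->
  exists ij : 'I_N * 'I_M, d ij.1 ij.2 < 0.
Proof.
move=> d0 dr; apply: contraPP d0 => noNeg; apply/negP; rewrite negbK.
apply/eqP/matrixP => i j; rewrite mxE.
apply: (psumr_eq0P (P := predT) (F := d i)) => // k _.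
by rewrite leNgt; apply/negP => dik; apply: noNeg; exists (i, k).
Qed.

(** Ratio test: [s] is the smallest of the step lengths at which some
    decreasing entry of [q + s *: d] reaches zero. *)
Lemma push_to_boundary (R : realType) (N M : nat) (mu : 'rV[R]_N)
    (nu : 'rV[R]_M) (q d : 'M[R]_(N, M)) :
  couplings mu nu q -> d != 0 ->
  (forall i, \sum_j d i j = 0) -> (forall j, \sum_i d i j = 0) ->
  exists s : R, [/\ 0 <= s, couplings mu nu (q + s *: d)
    & exists i j, d i j != 0 /\ (q + s *: d) i j = 0].
Proof.
move=> [q0 qr qc] dN0 dr dc.
have [ij0 neg0] := exists_negative_entry dN0 dr.
pose step (ij : 'I_N * 'I_M) := q ij.1 ij.2 / - d ij.1 ij.2.
case: (Order.TotalTheory.arg_minP (P := fun ij => d ij.1 ij.2 < 0)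
  step neg0) => -[i j] /= neg stepmin.
have s0 : 0 <= step (i, j) by rewrite divr_ge0 // oppr_ge0 ltW.
exists (step (i, j)); split=> //.
  split=> [a b|a|b].
  - rewrite !mxE; have [dge|dlt] := leP 0 (d a b).
      by rewrite addr_ge0 // mulr_ge0.
    have := stepmin (a, b) dlt.
    by rewrite {2}/step /= ler_pdivlMr ?oppr_gt0 // mulrN -subr_ge0 opprK.
  - under eq_bigr do rewrite !mxE.
    by rewrite big_split /= -mulr_sumr dr mulr0 addr0.
  - under eq_bigr do rewrite !mxE.
    by rewrite big_split /= -mulr_sumr dc mulr0 addr0.
exists i, j; split; first by rewrite lt_eqF.
by rewrite !mxE /step /= invrN mulrN mulNr divfK ?subrr // lt_eqF.
Qed.

(** By induction on the size of the support, which strictly decreases at each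
    move to the boundary. *)
Lemma extreme_point_below (R : realType) (N M : nat) (c : 'M[R]_(N, M))
    (mu : 'rV[R]_N) (nu : 'rV[R]_M) (q : 'M[R]_(N, M)) :
  couplings mu nu q ->
  exists2 v, extreme_points (couplings mu nu) v
    & frobenius c v <= frobenius c q.
Proof.
pose supp (r : 'M[R]_(N, M)) := [pred ij : 'I_N * 'I_M | r ij.1 ij.2 != 0].
have [n] := ubnP #|supp q|; elim: n q => // n IH q; rewrite ltnS => suppq qC.
have [?|qNext] := pselect (extreme_points (couplings mu nu) q).
  by exists q.
have [d [dN0 dr dc dsupp cd]] : exists d : 'M[R]_(N, M),
    [/\ d != 0, forall i, \sum_j d i j = 0, forall j, \sum_i d i j = 0,
      forall i j, q i j = 0 -> d i j = 0 & frobenius c d <= 0].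
  have [d [dN0 dr dc dsupp]] := nonextreme_direction qC qNext.
  have [cd|/ltW cd] := leP (frobenius c d) 0; first by exists d.
  exists (- d); split=> [|i|j|i j q0|].
  - by rewrite oppr_eq0.
  - by under eq_bigr do rewrite mxE; rewrite sumrN dr oppr0.
  - by under eq_bigr do rewrite mxE; rewrite sumrN dc oppr0.
  - by rewrite mxE dsupp ?oppr0.
  - by rewrite -scaleN1r frobeniusZr mulN1r oppr_le0.
have [s [s0 qC' [i [j [dij q'ij]]]]] := push_to_boundary qC dN0 dr dc.
have lt_supp : (#|supp (q + s *: d)%R| < #|supp q|)%N.
  apply/proper_card/properP; split.
    apply/fintype.subsetP => -[a b]; rewrite !inE /=; apply: contraNN.
    by move=> /eqP q0; rewrite !mxE q0 dsupp // mulr0 addr0.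
  exists (i, j); rewrite !inE /= ?q'ij ?eqxx //.
  by apply: contraNN dij => /eqP /dsupp ->.
have [v vext vle] := IH _ (leq_trans lt_supp suppq) qC'.
exists v => //; apply: le_trans vle _.
by rewrite frobeniusDr frobeniusZr gerDl mulr_ge0_le0.
Qed.

(** * Consistency as a linear system *)

Lemma ot_cost_eqP (R : realType) (N M : nat) (c : 'M[R]_(N, M))
    (mu : 'rV[R]_N) (nu : 'rV[R]_M) (p : 'M[R]_(N, M)) :
  simplex mu -> simplex nu -> couplings mu nu p ->
  ot_cost c mu nu = frobenius c p <->
  forall q, couplings mu nu q -> frobenius c p <= frobenius c q.
Proof.
move=> hmu hnu pC; have [r rC [-> rmin]] := ot_cost_min c hmu hnu.
split=> [<- //|pmin]; apply/eqP.
by rewrite eq_le rmin //= pmin.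
Qed.

Lemma consistent_solves_system (R : realType) (K N M : nat)
    (mu : 'I_K -> 'rV[R]_N) (nu : 'I_K -> 'rV[R]_M)
    (alpha : 'I_K -> R) (p : 'I_K -> 'M[R]_(N, M)) (L : 'I_K -> nat)
    (u : forall k : 'I_K, 'I_(L k) -> 'M[R]_(N, M)) (c : 'M[R]_(N, M)) :
  (forall k, simplex (mu k)) -> (forall k, simplex (nu k)) ->
  (forall k, couplings (mu k) (nu k) (p k)) ->
  (forall k, generating_family (mu k) (nu k) (p k) (u k)) ->
  consistent mu nu alpha p c <-> solves_system mu nu alpha u c.
Proof.
move=> hmu hnu hp hu; split=> [cons|[ge_alpha eq_alpha] k].
  have lb k q : couplings (mu k) (nu k) q -> alpha k <= frobenius c q.
    have [costE planE] := cons k; rewrite planE.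
    by apply: (ot_cost_eqP c (hmu k) (hnu k) (hp k)).1; rewrite costE.
  split=> [k v [[vC _] _]|k]; first exact: lb.
  have [uext [lam [lamS lam_gt0 pE]]] := hu k.
  apply: (weighted_mean_eq_lb lamS lam_gt0) => [l|].
    by apply: lb; case: (uext l).
  by rewrite -frobenius_sumr -pE (cons k).2.
have [uext [lam [[_ lam1] _ pE]]] := hu k.
have planE : frobenius c (p k) = alpha k.
  rewrite pE frobenius_sumr; under eq_bigr do rewrite eq_alpha.
  by rewrite -mulr_suml lam1 mul1r.
split=> //; rewrite -planE; apply/ot_cost_eqP => // q qC.
have [v vext] := extreme_point_below c qC.
apply: le_trans; rewrite planE.
have [[l _ <-]|vNu] := pselect (range (u k) v); first by rewrite eq_alpha.
by apply: (ge_alpha k).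
Qed.

Theorem theorem2p23 (R : realType) (K N M : nat)
    (mu : 'I_K -> 'rV[R]_N) (nu : 'I_K -> 'rV[R]_M)
    (hmu : forall k, simplex (mu k))
    (hnu : forall k, simplex (nu k))
    (hdistinct : injective (fun k => (mu k, nu k)))
    (alpha : 'I_K -> R)
    (p : 'I_K -> 'M[R]_(N, M))
    (hp : forall k, couplings (mu k) (nu k) (p k))
    (L : 'I_K -> nat)
    (u : forall k : 'I_K, 'I_(L k) -> 'M[R]_(N, M))
    (hu : forall k, generating_family (mu k) (nu k) (p k) (u k)) :
  ((exists c : 'M[R]_(N, M), consistent mu nu alpha p c) ->
     (identifiable mu nu alpha p <->
      exists! c : 'M[R]_(N, M), solves_system mu nu alpha u c)) /\
  ((exists c : 'M[R]_(N, M), solves_system mu nu alpha u c) ->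
     exists c : 'M[R]_(N, M), consistent mu nu alpha p c).
Proof.
rewrite /identifiable.
have -> : consistent mu nu alpha p = solves_system mu nu alpha u.
  by apply/funext => c; apply/propext/consistent_solves_system.
by split.
Qed.
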